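(* Let $\delta t>0$ and let $\mathbf{a}^{n-1},\mathbf{a}^n\in\mathbb{R}^{2r}$ be given. Consider the Crank–Nicolson scheme that determines $\mathbf{a}^{n+1}\in\mathbb{R}^{2r}$ from $$\mathbf{U}^T\mathcal{L}_h^{*}\mathbf{U}\,\frac{\mathbf{a}^{n+1}-\mathbf{a}^n}{\delta t}=-\mathbf{U}^T\mathcal{L}_h^{*}\,\mathcal{N}_h\big(\mathbf{U}\overline{\mathbf{a}}^{n+\frac12}\big)\,\mathcal{L}_h\big[\mathbf{U}\mathbf{a}^{n+\frac12}\big],$$ where $\overline{\mathbf{a}}^{n+\frac12}=\frac32\mathbf{a}^n-\frac12\mathbf{a}^{n-1}$ and $\mathbf{a}^{n+\frac12}=\frac12\mathbf{a}^{n+1}+\frac12\mathbf{a}^n$. This scheme is linear (i.e. it is a linear system of equations for the unknown $\mathbf{a}^{n+1}$), and its solution satisfies the discrete energy dissipation law $$\mathcal{E}_r(\mathbf{U}\mathbf{a}^{n+1})-\mathcal{E}_r(\mathbf{U}\mathbf{a}^n)=-\delta t\,\Big(\mathcal{L}_h[\mathbf{U}\mathbf{a}^{n+\frac12}]\Big)^T\mathcal{N}_h\big(\mathbf{U}\overline{\mathbf{a}}^{n+\frac12}\big)\Big(\mathcal{L}_h[\mathbf{U}\mathbf{a}^{n+\frac12}]\Big),$$ where $\mathcal{E}_r(\mathbf{U}\mathbf{a})=\frac12(\mathbf{U}\mathbf{a})^T\mathcal{L}_h(\mathbf{U}\mathbf{a})$.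
   Context: Setting (spatially discretized, energy-quadratized system). Let $N\ge 1$ be the number of spatial grid points and $1\le r\le N$. The full discrete state is $\Psi=\begin{bmatrix}\phi\\ q\end{bmatrix}\in\mathbb{R}^{2N}$ with $\phi,q\in\mathbb{R}^N$. Linear operator: $\mathcal{L}_h=\begin{bmatrix}\mathcal{L}_{0,h}&0\\0&\mathbf{I}_N\end{bmatrix}$, where $\mathcal{L}_{0,h}\in\mathbb{R}^{N\times N}$ is symmetric, positive semi-definite and invertible (hence positive definite); $\mathcal{L}_h^{*}=\mathcal{L}_h^T$ denotes its adjoint. Mobility: $\mathcal{N}_h(\Psi)=\mathcal{N}_0(\Psi)^T(\mathcal{G}_a+\mathcal{G}_s)\mathcal{N}_0(\Psi)\in\mathbb{R}^{2N\times 2N}$, where $\mathcal{G}_a\in\mathbb{R}^{N\times N}$ is skew-symmetric, $\mathcal{G}_s\in\mathbb{R}^{N\times N}$ is symmetric positive semi-definite, and $\mathcal{N}_0(\Psi)=\begin{bmatrix}\mathbf{I}_N & \mathrm{diag}(g(\phi))\end{bmatrix}\in\mathbb{R}^{N\times 2N}$ with $g:\mathbb{R}\to\mathbb{R}$ a given function applied componentwise to $\phi$. Reduced basis: $\mathbf{U}=\begin{bmatrix}\mathbf{U}_\phi&0\\0&\mathbf{U}_q\end{bmatrix}\in\mathbb{R}^{2N\times 2r}$, where $\mathbf{U}_\phi,\mathbf{U}_q\in\mathbb{R}^{N\times r}$ have orthonormal columns (leading left singular vectors of snapshot matrices), so $\mathbf{U}^T\mathbf{U}=\mathbf{I}_{2r}$.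 The reduced unknowns are $\mathbf{a}^k=\begin{bmatrix}\mathbf{a}_\phi^k\\ \mathbf{a}_q^k\end{bmatrix}\in\mathbb{R}^{2r}$, where the superscript $k$ is the time-step index. *)

(* Defs.v *)
From mathcomp Require Import all_boot all_order all_algebra.
From mathcomp Require Import reals.

Set Implicit Arguments.
Unset Strict Implicit.
Unset Printing Implicit Defensive.

Import Order.TTheory GRing.Theory Num.Theory.
Local Open Scope ring_scope.

Section Defs.
Context {R : realType}.

Definition possemidef n (A : 'M[R]_n) : Prop :=
  forall x : 'cV[R]_n, 0 <= (x^T *m A *m x) 0 0.

(* The equation [lhs x = rhs x] is a linear system for the unknown [x]: its
   residual is affine.  It is then the system [A *m x = b]. *)
Definition linear_system m p (lhs rhs : 'cV[R]_m -> 'cV[R]_p) : Prop :=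
  exists (A : 'M[R]_(p, m)) (b : 'cV[R]_p),
    forall x, lhs x - rhs x = A *m x - b.

(* Elements of R^(2N) are [Psi = col_mx phi q : 'cV_(N + N)], so that [phi] is
   [usubmx Psi]. *)

Definition Lh N (L0 : 'M[R]_N) : 'M[R]_(N + N) := block_mx L0 0 0 1%:M.

Definition N0 N (g : R -> R) (Psi : 'cV[R]_(N + N)) : 'M[R]_(N, N + N) :=
  row_mx 1%:M (diag_mx (map_mx g (usubmx Psi))^T).

Definition Nh N (g : R -> R) (Ga Gs : 'M[R]_N) (Psi : 'cV[R]_(N + N)) :
    'M[R]_(N + N) :=
  (N0 g Psi)^T *m (Ga + Gs) *m N0 g Psi.

Definition reduced_basis N r (Uphi Uq : 'M[R]_(N, r)) : 'M[R]_(N + N, r + r) :=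
  block_mx Uphi 0 0 Uq.

Definition energy N (L0 : 'M[R]_N) (Psi : 'cV[R]_(N + N)) : R :=
  1 / 2 * (Psi^T *m Lh L0 *m Psi) 0 0.

Definition extrapolated m (aprev an : 'cV[R]_m) : 'cV[R]_m :=
  (3 / 2) *: an - (1 / 2) *: aprev.

Definition midpoint m (an anext : 'cV[R]_m) : 'cV[R]_m :=
  (1 / 2) *: anext + (1 / 2) *: an.

Definition CN_lhs N r (L0 : 'M[R]_N) (U : 'M[R]_(N + N, r + r)) (dt : R)
    (an anext : 'cV[R]_(r + r)) : 'cV[R]_(r + r) :=
  U^T *m (Lh L0)^T *m U *m (dt^-1 *: (anext - an)).

Definition CN_rhs N r (L0 : 'M[R]_N) (g : R -> R) (Ga Gs : 'M[R]_N)
    (U : 'M[R]_(N + N, r + r)) (aprev an anext : 'cV[R]_(r + r)) :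
    'cV[R]_(r + r) :=
  - (U^T *m (Lh L0)^T *m Nh g Ga Gs (U *m extrapolated aprev an)
       *m (Lh L0 *m (U *m midpoint an anext))).

End Defs.

(* Main.v *)
(** The Crank-Nicolson midpoint turns the difference of two values of the quadratic
    energy into the product of the midpoint with the increment, so testing the
    scheme against the reduced midpoint [a^(n+1/2)] gives the energy law. *)

Require Import Defs.
From mathcomp Require Import all_boot all_order all_algebra.
From mathcomp Require Import reals.

Import Order.TTheory GRing.Theory Num.Theory.
Local Open Scope ring_scope.

Lemma symmetricmx_trmx (R : fieldType) n (A : 'M[R]_n) :
  A \is symmetricmx -> A^T = A.
Proof. by move=> /is_hermitianmxP; rewrite expr0 scale1r map_mx_id. Qed.

Lemma trmx_Lh (R : realType) N (L0 : 'M[R]_N) :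
  L0^T = L0 -> (Lh L0)^T = Lh L0.
Proof. by move=> L0T; rewrite /Lh tr_block_mx L0T !trmx0 trmx1. Qed.

(** On expanding the product, the two cross terms cancel because [S] is symmetric. *)
Lemma quadratic_formB (R : comNzRingType) m (S : 'M[R]_m) (x y : 'cV[R]_m) :
  S^T = S ->
  x^T *m S *m x - y^T *m S *m y = (x + y)^T *m S *m (x - y).
Proof.
move=> ST; have cross : y^T *m S *m x = x^T *m S *m y.
  (* A 1x1 matrix is scalar, hence equal to its own transpose. *)
  by rewrite [LHS]mx11_scalar -tr_scalar_mx -mx11_scalar !trmx_mul trmxK ST mulmxA.
by rewrite [(x + y)^T]linearD /= !mulmxDl !mulmxBr cross addrA subrK.
Qed.

(** The factor 1/2 of the energy turns the sum [b + a] into the midpoint, so the identity is exact,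
    with no remainder in the step size. *)
Lemma energyB (R : realType) N m (L0 : 'M[R]_N) (U : 'M[R]_(N + N, m))
    (a b : 'cV[R]_m) :
  L0^T = L0 ->
  energy L0 (U *m b) - energy L0 (U *m a) =
  ((U *m midpoint a b)^T *m Lh L0 *m (U *m (b - a))) 0 0.
Proof.
move=> L0T; rewrite /energy /midpoint -mulrBr -scalerDr -scalemxAr linearZ /=.
rewrite -!scalemxAl [RHS]mxE; congr (_ * _).
have := quadratic_formB _ _ (Lh L0) (U *m b) (U *m a) (trmx_Lh _ _ _ L0T).
by rewrite -mulmxDr -mulmxBr => <-; rewrite !mxE.
Qed.

(** The mobility is evaluated at the extrapolated state, which depends only on [aprev] and [an];
    hence [K] is constant in the unknown. *)
Lemma CN_linear (R : realType) N r (L0 : 'M[R]_N) (g : R -> R)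
    (Ga Gs : 'M[R]_N) (U : 'M[R]_(N + N, r + r)) (dt : R)
    (aprev an : 'cV[R]_(r + r)) :
  linear_system (CN_lhs L0 U dt an) (CN_rhs L0 g Ga Gs U aprev an).
Proof.
rewrite /linear_system /CN_lhs /CN_rhs /midpoint.
set P := U^T *m _ *m U; set K := _ *m Nh _ _ _ _.
(* The unknown enters through the difference quotient and, with weight 1/2, through the midpoint;
   the [an] parts of both go into [b]. *)
exists (dt^-1 *: P + (1 / 2) *: (K *m Lh L0 *m U)).
exists (dt^-1 *: (P *m an) - (1 / 2) *: (K *m Lh L0 *m U *m an)) => x.
rewrite opprK !mulmxA mulmxDr mulmxDl -!scalemxAr -!scalemxAl mulmxBr scalerBr.
by rewrite addrACA opprB [X in _ + X]addrC.
Qed.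

Theorem theorem4p1 (R : realType) (N r : nat)
    (hN : (1 <= N)%N) (hr : (1 <= r <= N)%N)
    (L0 : 'M[R]_N) (L0_sym : L0 \is symmetricmx) (L0_psd : possemidef L0)
    (L0_inv : L0 \in unitmx)
    (Ga Gs : 'M[R]_N) (Ga_skew : Ga \is skewmx) (Gs_sym : Gs \is symmetricmx)
    (Gs_psd : possemidef Gs)
    (g : R -> R)
    (Uphi Uq : 'M[R]_(N, r))
    (Uphi_orth : Uphi^T *m Uphi = 1%:M) (Uq_orth : Uq^T *m Uq = 1%:M)
    (dt : R) (dt_gt0 : 0 < dt)
    (aprev an : 'cV[R]_(r + r)) :
  let U := reduced_basis Uphi Uq in
  linear_system (CN_lhs L0 U dt an) (CN_rhs L0 g Ga Gs U aprev an) /\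
  (forall anext : 'cV[R]_(r + r),
     CN_lhs L0 U dt an anext = CN_rhs L0 g Ga Gs U aprev an anext ->
     let mu := Lh L0 *m (U *m midpoint an anext) in
     energy L0 (U *m anext) - energy L0 (U *m an) =
     - dt * (mu^T *m Nh g Ga Gs (U *m extrapolated aprev an) *m mu) 0 0).
Proof.
move=> U; split; first exact: CN_linear.
move=> anext scheme mu; have L0T := symmetricmx_trmx _ _ _ L0_sym.
have LT := trmx_Lh _ _ _ L0T.
have step : U^T *m Lh L0 *m U *m (anext - an) =
    dt *: CN_lhs L0 U dt an anext.
  by rewrite /CN_lhs LT -scalemxAr scalerA divff ?gt_eqF// scale1r.
rewrite energyB// trmx_mul !mulmxA.
(* Reassociating isolates the left-hand side of [step], tested against the transposed midpoint. *)
rewrite -[in LHS](mulmxA _ U^T) -[in LHS](mulmxA _ _ U) -(mulmxA _ _ (anext - an)).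
rewrite step scheme /CN_rhs -/mu -scalemxAr mulmxN scalerN -scaleNr mxE.
(* The factor [U^T *m (Lh L0)^T] of the scheme completes the transposed midpoint to [mu^T]. *)
by rewrite /mu !trmx_mul !mulmxA.
Qed.
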